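(* Let $k\ge0$ be an integer, let $K\in\mathcal C_k(G)$, and let $\mathscr Z^K$ be a $\mathbb Z$-basis of $Z_1(K)$. In $\bigwedge^kC_1(G)$, the following identity holds: $$\det\mathscr Z^K=\sum_{T\in\mathcal T(G),\,T\subseteq K}\det(\mathscr Z^K/\mathscr Z^K_T)\;e_{K\setminus T}.$$
   Context: $G=(V,E)$ is a finite connected graph: $V$ is a finite set of vertices and $E$ a finite set of oriented edges, with source and target maps $s,t:E\to V$ and a fixed-point-free involution $e\mapsto e^{-1}$ of $E$ exchanging source and target. $E^+\subset E$ is a fixed subset containing exactly one element of each pair $\{e,e^{-1}\}$, with a fixed total order. A subgraph is a subset $S\subseteq E$ stable under $e\mapsto e^{-1}$, seen as the graph $(V,S)$; $S^+=S\cap E^+$. $\mathcal T(G)$ is the set of spanning trees; $\mathcal C_k(G)$ is the set of connected (spanning) subgraphs with first Betti number $k$. $C_1(G)$ is the free abelian group on $E$ modulo $e+e^{-1}=0$ (free with basis $E^+$); $C_0(G)$ is the free abelian group on $V$; $\partial e=t(e)-s(e)$; $Z_1(G)=\ker\partial$; $C_1(K)$ is the subgroup generated by the edges of $K$ and $Z_1(K)=Z_1(G)\cap C_1(K)$. For a spanning tree $T$ one has $C_1(G)=C_1(T)\oplus Z_1(G)$, and $\mathsf Z_T:C_1(G)\to Z_1(G)$ is the corresponding projection. For $T\subseteq K$, $\mathscr Z^K_T=(\mathsf Z_T(e):e\in(K\setminus T)^+)$, in the order of $E^+$, is a $\mathbb Z$-basis of $Z_1(K)$. For a basis $\mathscr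 B=(u_1,\dots,u_k)$ of a free $\mathbb Z$-module, $\det\mathscr B=u_1\wedge\dots\wedge u_k$, and for two bases $\mathscr B_1,\mathscr B_2$ of the same module, $\det(\mathscr B_1/\mathscr B_2)=\pm1$ is the determinant of the matrix of $\mathscr B_1$ in $\mathscr B_2$. For $S\subseteq E$ with $S\cap E^+=\{e_1<\dots<e_r\}$, $e_S=e_1\wedge\dots\wedge e_r$. *)

(* Defs.v *)
From HB Require Import structures.
From mathcomp Require Import all_boot all_order all_algebra.
From mathcomp Require Import generic_quotient ring_quotient.
From mathcomp Require Import boolp classical_sets.
From mathcomp Require Import freeg.

Set Implicit Arguments.
Unset Strict Implicit.
Unset Printing Implicit Defensive.

Import GRing.Theory Num.Theory.

Local Open Scope quotient_scope.
Local Open Scope ring_scope.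

Inductive subgroup_gen (M : zmodType) (S : M -> Prop) : M -> Prop :=
| subgroup_gen0 : subgroup_gen S 0
| subgroup_genB x y :
    subgroup_gen S x -> subgroup_gen S y -> subgroup_gen S (x - y)
| subgroup_gen_in x : S x -> subgroup_gen S x.

(* The abelian group with generators X and relators R.                        *)

Section Presentation.
Variables (X : choiceType) (R : {freeg X} -> Prop).

Definition relators : {pred {freeg X}} := fun x => `[< subgroup_gen R x >].

Fact relators_zmod_closed : zmod_closed relators.
Proof.
split=> [|x y /asboolP Rx /asboolP Ry]; apply/asboolP.
  exact: subgroup_gen0.
exact: subgroup_genB.
Qed.
HB.instance Definition _ :=
  GRing.isZmodClosed.Build {freeg X} relators relators_zmod_closed.

Definition presented := Quotient.quot relators.
HB.instance Definition _ := Choice.on presented.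
HB.instance Definition _ := GRing.Zmodule.on presented.

Definition pclass (x : {freeg X}) : presented := \pi_(Quotient.quot relators) x.
Definition prepr (c : presented) : {freeg X} :=
  repr (c : Quotient.quot relators).
Definition generator (x : X) : presented := pclass << x >>.

Lemma pclassB x y : pclass (x - y) = pclass x - pclass y.
Proof. by rewrite /pclass raddfB. Qed.

Lemma preprK c : pclass (prepr c) = c.
Proof. by rewrite /pclass /prepr reprK. Qed.

Lemma pclass_eqP x y : pclass x = pclass y <-> subgroup_gen R (x - y).
Proof.
split=> [/eqP|Rxy]; first by rewrite -Quotient.idealrBE => /asboolP.
by apply/eqP; rewrite -Quotient.idealrBE; apply/asboolP.
Qed.

End Presentation.

Section ZModules.
Variable M : zmodType.
Implicit Types (N : M -> Prop) (k : nat).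

Definition is_zbasis N k (u : 'I_k -> M) : Prop :=
  (forall i, N (u i)) /\
  (forall x, N x -> exists! a : {ffun 'I_k -> int}, x = \sum_i u i *~ a i).

(* Only meaningful when N is a free subgroup of finite rank.                  *)
Definition zrank N : nat :=
  xget 0%N (fun k => exists u : 'I_k -> M, is_zbasis N u).

Definition basis_matrix k (u v : 'I_k -> M) : 'M[int]_k :=
  xget 0 (fun A : 'M[int]_k => forall j, u j = \sum_i v i *~ A i j).

Definition basis_det k (u v : 'I_k -> M) : int := \det (basis_matrix u v).

(* Coerces a sequence known to have length k to a k-indexed family; the       *)
(* default value of nth is never reached in that case.                        *)
Definition seq_family k (s : seq M) : 'I_k -> M := fun i => nth 0 s i.

End ZModules.

Arguments seq_family {M} k s.

(* The k-th exterior power of M over Z, generated by the symbols              *)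
(* u_1 /\ ... /\ u_k. Additivity in each slot implies Z-multilinearity.       *)

Section ExteriorPower.
Variables (M : zmodType) (k : nat).
Implicit Types (u : {ffun 'I_k -> M}) (i j : 'I_k).

Definition set_slot u i (x : M) : {ffun 'I_k -> M} :=
  [ffun j => if j == i then x else u j].

Inductive ext_relator : {freeg {ffun 'I_k -> M}} -> Prop :=
| ext_additive u i x y :
    ext_relator (<< set_slot u i (x + y) >>
                 - (<< set_slot u i x >> + << set_slot u i y >>))
| ext_alternating u i j : i != j -> u i = u j -> ext_relator << u >>.

Definition exterior_power := presented ext_relator.
HB.instance Definition _ := Choice.on exterior_power.
HB.instance Definition _ := GRing.Zmodule.on exterior_power.

Definition wedge (u : 'I_k -> M) : exterior_power :=
  generator ext_relator (finfun u).

End ExteriorPower.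

Record graph := Graph {
  vertex : finType;
  edge : finType;
  src : edge -> vertex;
  tgt : edge -> vertex;
  einv : edge -> edge;
  einvK : involutive einv;
  einv_neq : forall e, einv e != e;
  src_einv : forall e, src (einv e) = tgt e
}.

Lemma tgt_einv (G : graph) (e : edge G) : tgt (einv e) = src e.
Proof. by rewrite -src_einv einvK. Qed.

Record orientation (G : graph) := Orientation {
  positive : {set edge G};
  positive_einv : forall e, (einv e \in positive) = (e \notin positive);
  edge_le : rel (edge G);
  edge_le_anti : {in positive &, antisymmetric edge_le};
  edge_le_trans : {in positive & &, transitive edge_le};
  edge_le_total : {in positive &, total edge_le}
}.

Section Subgraphs.
Variable G : graph.
Implicit Types S : {set edge G}.

Definition is_subgraph S : bool := [forall e in S, einv e \in S].

Definition adjacent S : rel (vertex G) :=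
  fun x y => [exists e in S, (src e == x) && (tgt e == y)].

Definition is_connected S : bool :=
  (0 < #|vertex G|)%N && [forall x, forall y, connect (adjacent S) x y].

(* Loops (length 1) and double edges (length 2) count as cycles, but e, e^-1  *)
(* does not.                                                                  *)
Definition simple_cycle S (c : seq (edge G)) : bool :=
  [&& c != [::], all [in S] c, cycle (fun e f => tgt e == src f) c,
      uniq [seq src e | e <- c] & all (fun e => einv e \notin c) c].

Definition is_acyclic S : Prop := ~ exists c, simple_cycle S c.

Definition spanning_trees : {set {set edge G}} :=
  [set S | [&& is_subgraph S, is_connected S & `[< is_acyclic S >]]].

End Subgraphs.

Section Chains.
Variable G : graph.
Implicit Types S T : {set edge G}.

Inductive edge_relator : {freeg (edge G)} -> Prop :=
| edge_relation e : edge_relator (<< e >> + << einv e >>).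

Definition C1 := presented edge_relator.
HB.instance Definition _ := Choice.on C1.
HB.instance Definition _ := GRing.Zmodule.on C1.

Definition C0 := {freeg (vertex G)}.

Definition edge_chain (e : edge G) : C1 := generator edge_relator e.

(* The boundary is computed on a representative of the class in Z[E].         *)
Definition boundary (c : C1) : C0 :=
  \sum_(e <- dom (prepr c)) (<< tgt e >> - << src e >>) *~ coeff e (prepr c).

Definition cycles (c : C1) : Prop := boundary c = 0.

Definition chains_on S : C1 -> Prop :=
  subgroup_gen (fun c => exists2 e, e \in S & c = edge_chain e).

Definition cycles_on S (c : C1) : Prop := cycles c /\ chains_on S c.

(* b_1(S) = rank of H_1((V, S); Z) = Z_1(S).                                  *)
Definition betti S : nat := zrank (cycles_on S).

Definition connected_subgraphs (k : nat) : {set {set edge G}} :=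
  [set S | [&& is_subgraph S, is_connected S & betti S == k]].

(* The projection onto Z_1(G) along C_1(T), for T a spanning tree.            *)
Definition tree_proj T (c : C1) : C1 :=
  xget 0 (fun z : C1 => cycles z /\ chains_on T (c - z)).

Variable o : orientation G.

Definition positive_edges S : seq (edge G) :=
  sort (edge_le o) (enum (S :&: positive o)).

Definition tree_basis (K T : {set edge G}) (k : nat) : 'I_k -> C1 :=
  seq_family k [seq tree_proj T (edge_chain e) | e <- positive_edges (K :\: T)].

Definition edge_wedge (k : nat) S : exterior_power C1 k :=
  wedge (seq_family k [seq edge_chain e | e <- positive_edges S]).

End Chains.

Arguments tree_basis {G} o K T k.

Lemma edge_chain_einv (G : graph) (e : edge G) :
  edge_chain (einv e) = - edge_chain e.
Proof.
rewrite -sub0r -(subrr (pclass (edge_relator (G:=G)) 0)) /edge_chain /generator.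
rewrite -!pclassB subr0 sub0r; apply/pclass_eqP; rewrite opprK addrC.
exact/subgroup_gen_in/edge_relation.
Qed.

Lemma boundary_edge_chain (G : graph) (e : edge G) :
  boundary (edge_chain e) = << tgt e >> - << src e >>.
Proof.
pose d e' : C0 G := << tgt e' >> - << src e' >>.
pose D (x : {freeg (edge G)}) : C0 G := \sum_e d e *~ coeff e x.
have DE x : \sum_(e <- dom x) d e *~ coeff e x = D x.
  rewrite /D [RHS](bigID (fun e => e \in dom x)) /= [X in _ + X]big1 ?addr0.
    rewrite -[RHS]big_filter; apply: perm_big; apply: uniq_perm.
    - exact: uniq_dom.
    - by rewrite filter_uniq ?index_enum_uniq.
    by move=> e'; rewrite mem_filter mem_index_enum andbT.
  by move=> e' /coeff_outdom ->; rewrite mulr0z.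
have DB x y : D (x - y) = D x - D y.
  by rewrite /D -sumrB; apply: eq_bigr => e' _; rewrite coeffB mulrzBr.
have DU e' : D << e' >> = d e'.
  rewrite /D (bigD1 e') //= coeffU eqxx mulr1 mulr1z big1 ?addr0 // => f.
  by rewrite coeffU eq_sym => /negPf->; rewrite mulr0 mulr0z.
have D0 : D 0 = 0 by rewrite /D big1 // => f _; rewrite coeff0 mulr0z.
have DN x : D (- x) = - D x by rewrite -sub0r DB D0 sub0r.
have DR x : subgroup_gen (@edge_relator G) x -> D x = 0.
  elim=> [//|y z _ Dy _ Dz|_ [e']]; first by rewrite DB Dy Dz subr0.
  rewrite -[<< einv e' >>]opprK DB DN !DU opprK.
  by rewrite /d src_einv tgt_einv addrC subrKA subrr.
rewrite /boundary DE -[RHS](DU e); apply/eqP; rewrite -subr_eq0 -DB.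
by apply/eqP/DR/pclass_eqP; rewrite preprK.
Qed.

Lemma wedge_set_slotD (M : zmodType) (k : nat) (u : {ffun 'I_k -> M}) i x y :
  wedge (set_slot u i (x + y)) =
  wedge (set_slot u i x) + wedge (set_slot u i y).
Proof.
rewrite /wedge /generator !ffunK.
set R := @ext_relator M k.
have pclassD a b : pclass R (a + b) = pclass R a + pclass R b.
  by rewrite /pclass raddfD.
by rewrite -pclassD; apply/pclass_eqP/subgroup_gen_in/ext_additive.
Qed.

Lemma wedge_alternate (M : zmodType) (k : nat) (u : 'I_k -> M) i j :
  i != j -> u i = u j -> wedge u = 0.
Proof.
move=> ij uij; rewrite -[RHS](subrr (pclass (@ext_relator M k) 0)) -pclassB.
apply/pclass_eqP; rewrite !subr0; apply: subgroup_gen_in.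
by apply: (ext_alternating ij); rewrite !ffunE.
Qed.

(* Main.v *)
Require Import Defs.
From HB Require Import structures.
From mathcomp Require Import all_boot all_order all_fingroup all_algebra.
From mathcomp Require Import boolp freeg.
From mathcomp Require classical_sets.

(* Expanding each element of ZK in the basis K^+ of C_1(K) writes its wedge   *)
(* as the sum, over the k-subsets S of K^+, of e_S times the k x k minor on S *)
(* of the coordinate matrix. Let T be K minus the edges of S and their        *)
(* inverses. If T is a spanning tree, then Z_T(e) - e lies in C_1(T) for e in *)
(* S, so the coordinates of a cycle on S are its coordinates in the basis     *)
(* Z_T^K and the minor is det(ZK / Z_T^K). Otherwise the minor vanishes: a    *)
(* cycle in T, or a cut of K contained in S when T is disconnected, gives a   *)
(* kernel vector.                                                             *)

Set Implicit Arguments.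
Unset Strict Implicit.
Unset Printing Implicit Defensive.

Import Order.TTheory GRing.Theory Num.Theory.
Local Open Scope ring_scope.

(** Both sides are governed by the matrix of coordinates of [ZK] along the positive edges of [K].
    [wedge_minors] expands the left side by multilinearity into the maximal minors of this matrix,
    one for each k-subset S of those edges.

    For a spanning tree T in K, the coordinates along (K \ T)^+ are dual to Z_T^K
    ([edge_coord_tree_basis]) and recover every cycle of K ([tree_basis_expansion]). Hence the minor
    on (K \ T)^+ is the change-of-basis determinant ([basis_matrix_tree]), and (K \ T)^+ has exactly
    k elements ([size_tree_basis]), so every such T occurs in the expansion.

    The remaining minors vanish ([det_coord_eq0]): a cycle of K avoiding S is a linear relation
    between rows, and a cut of K contained in S is one between columns. *)

Section Presentation.
Variables (X : choiceType) (R : {freeg X} -> Prop).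

HB.instance Definition _ :=
  GRing.isZmodMorphism.Build _ _ (pclass R) (@pclassB X R).

(** Every class is represented by an integer combination of generators, and closure under
    differences, together with 0, already yields negatives, sums and integer multiples. *)
Lemma presented_ind (P : presented R -> Prop) :
  P 0 -> (forall a b, P a -> P b -> P (a - b)) ->
  (forall x, P (generator R x)) -> forall c, P c.
Proof.
move=> P0 PB Pg c; rewrite -(preprK c) -[prepr c]freeg_sumE raddf_sum.
have PD a b : P a -> P b -> P (a + b).
  by move=> Pa Pb; rewrite -[b]opprK -[- b]sub0r; apply: (PB) => //; exact: PB.
elim: (dom _) => [|z s IH]; first by rewrite big_nil.
rewrite big_cons; apply: (PD) => //.
have PM n : P (generator R z *+ n).
  by elim: n => [|n IHn]; rewrite ?mulr0n // mulrS; exact: PD.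
rewrite -[coeff _ _]intz -freegU_mulz raddfMz.
by case: (coeff _ _) => n; [|rewrite NegzE mulrNz -sub0r; apply: (PB) => //];
  rewrite -pmulrn; apply: PM.
Qed.

End Presentation.

(** * Universal property of C_1(G) *)

Section ChainLift.
Variables (G : graph) (N : zmodType) (d : edge G -> N).
Hypothesis d_einv : forall e, d (einv e) = - d e.

Let freeg_lift (x : {freeg (edge G)}) : N := \sum_e d e *~ coeff e x.

Let freeg_liftB : zmod_morphism freeg_lift.
Proof.
move=> x y; rewrite /freeg_lift -sumrB; apply: eq_bigr => e _.
by rewrite coeffB mulrzBr.
Qed.

HB.instance Definition _ :=
  GRing.isZmodMorphism.Build _ _ freeg_lift freeg_liftB.

Let freeg_liftU e : freeg_lift << e >> = d e.
Proof.
rewrite /freeg_lift (bigD1 e) //= coeffU eqxx mulr1 mulr1z big1 ?addr0 // => f.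
by rewrite coeffU eq_sym => /negPf->; rewrite mulr0 mulr0z.
Qed.

Definition chain_lift (c : C1 G) : N := freeg_lift (prepr c).

(** Independence of the representative: two of them differ by an element of the subgroup generated
    by the relators, which [d_einv] sends to 0. *)
Let chain_lift_pclass x : chain_lift (pclass _ x) = freeg_lift x.
Proof.
apply/eqP; rewrite -subr_eq0 -raddfB; apply/eqP.
have /(pclass_eqP _ _ _).1 := preprK (pclass (@edge_relator G) x).
elim=> [|y z _ IHy _ IHz|_ [e]]; first by rewrite raddf0.
  by rewrite raddfB IHy IHz subr0.
by rewrite raddfD /= !freeg_liftU d_einv subrr.
Qed.

Lemma chain_lift_edge e : chain_lift (edge_chain e) = d e.
Proof. by rewrite chain_lift_pclass freeg_liftU. Qed.

Lemma chain_lift_is_zmod_morphism : zmod_morphism chain_lift.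
Proof.
move=> a b; rewrite -[a in LHS]preprK -[b in LHS]preprK -raddfB.
by rewrite chain_lift_pclass raddfB.
Qed.

End ChainLift.

(** * Multilinear expansion in the exterior power *)

Section WedgeExpansion.
Variables (M : zmodType) (k : nat).
Implicit Types u v : 'I_k -> M.

Lemma eq_wedge u v : u =1 v -> wedge u = wedge v.
Proof. by move=> uv; congr (generator _ _); apply/ffunP=> i; rewrite !ffunE. Qed.

Definition upd u i (x : M) : 'I_k -> M := fun j => if j == i then x else u j.

Definition wedge_slot u i x := wedge (upd u i x).

Lemma wedge_slot_is_zmod_morphism u i : zmod_morphism (wedge_slot u i).
Proof.
move=> x y; apply: (addIr (wedge_slot u i y)); rewrite subrK.
have E z : wedge_slot u i z = wedge (set_slot (finfun u) i z).
  by apply: eq_wedge => j; rewrite /upd !ffunE.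
by rewrite !E -wedge_set_slotD subrK.
Qed.

HB.instance Definition _ u i :=
  GRing.isZmodMorphism.Build _ _ (wedge_slot u i)
    (@wedge_slot_is_zmod_morphism u i).

(** The wedge with [u i + u j] in both slots is zero; expanding it leaves only the two mixed
    terms. *)
Lemma wedge_tperm u i j : i != j -> wedge (u \o tperm i j) = - wedge u.
Proof.
move=> ij; pose W x y := wedge (upd (upd u i x) j y).
have Wdiag x : W x x = 0.
  apply: (@wedge_alternate _ _ _ i j ij).
  by rewrite /upd (negPf ij) !eqxx.
have WDr x y z : W x (y + z) = W x y + W x z.
  exact: (raddfD (wedge_slot _ j)).
have WDl x y z : W (x + y) z = W x z + W y z.
  have E t : W t z = wedge_slot (upd u j z) i t.
    apply: eq_wedge => l; rewrite /upd.
    by case: eqP => // ->; rewrite eq_sym (negPf ij).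
  by rewrite !E raddfD.
have := Wdiag (u i + u j); rewrite WDl !WDr !Wdiag addr0 add0r => /eqP.
rewrite addrC addr_eq0 => /eqP WN.
have -> : wedge u = W (u i) (u j).
  apply: eq_wedge => l; rewrite /upd; case: eqP => [->//|_].
  by case: eqP => [->|].
rewrite -WN; apply: eq_wedge => l; rewrite /upd /=.
by case: tpermP => [->|->|/eqP/negPf-> /eqP/negPf->//];
  rewrite ?eqxx ?(negPf ij).
Qed.

Lemma wedge_perm u (s : 'S_k) : wedge (u \o s) = wedge u *~ (-1) ^+ s.
Proof.
have [ts -> {s}] := prod_tpermP s.
elim: ts u => [|t ts IH] u /=.
  by rewrite big_nil odd_perm1 mulr1z => _; apply: eq_wedge => i; rewrite /= perm1.
case/andP=> dt dts; rewrite big_cons odd_mul_tperm dt.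
rewrite signr_addb mulN1r mulrNz -(IH _ dts) -(wedge_tperm _ dt).
by apply: eq_wedge => i /=; rewrite permM.
Qed.

Section Expand.
Variables (I : finType) (b : I -> M) (A : 'I_k -> I -> int).

(** Only the slots in [s] are expanded, which allows induction on slots. Pinning [f] to [f0] outside
    [s] makes each choice of indices on [s] count once. *)
Lemma wedge_expand_seq (s : seq 'I_k) (f0 : {ffun 'I_k -> I}) u : uniq s ->
  wedge (fun j => if j \in s then \sum_i b i *~ A j i else u j) =
  \sum_(f : {ffun 'I_k -> I} | [forall j, (j \notin s) ==> (f j == f0 j)])
    wedge (fun j => if j \in s then b (f j) else u j) *~ \prod_(j <- s) A j (f j).
Proof.
elim: s f0 u => [|a s IH] f0 u /=.
  move=> _; rewrite (big_pred1 f0) ?big_nil ?mulr1z // => f /=.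
  apply/forallP/eqP => [E|->]; first by apply/ffunP=> j; apply/eqP/E.
  by move=> j; apply: eqxx.
case/andP=> as_ us.
pose w := fun j => if j \in s then \sum_i b i *~ A j i else u j.
transitivity (wedge_slot w a (\sum_i b i *~ A a i)).
  by apply: eq_wedge => j; rewrite /upd /w inE; case: eqP => [->|].
rewrite raddf_sum (partition_big (fun f : {ffun _} => f a) xpredT) //=.
apply: eq_bigr => i _; rewrite raddfMz.
pose f1 := [ffun j => if j == a then i else f0 j].
transitivity (wedge (fun j => if j \in s then \sum_i b i *~ A j i
                              else upd u a (b i) j) *~ A a i).
  congr (_ *~ _); apply: eq_wedge => j; rewrite /upd /w.
  by case: eqP => [->|//]; rewrite (negPf as_).
rewrite (IH f1) // mulrz_suml; apply: eq_big => f.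
  apply/forallP/andP => [E|[/forallP E /eqP fa] j].
    split; last by move: (E a); rewrite as_ ffunE eqxx.
    apply/forallP => j; rewrite inE negb_or; apply/implyP=> /andP[ja js].
    by move: (E j); rewrite js ffunE (negPf ja).
  apply/implyP => js; rewrite ffunE; case: (j =P a) => [->|/eqP ja]; first exact/eqP.
  by move: (E j); rewrite inE negb_or ja js.
move=> /forallP E.
have fa : f a = i by move: (E a); rewrite as_ ffunE eqxx => /eqP.
rewrite -mulrzA big_cons fa mulrC; congr (_ *~ _).
apply: eq_wedge => j; rewrite /upd inE; case: eqP => [->|//].
by rewrite (negPf as_) fa.
Qed.

Lemma wedge_expand :
  wedge (fun j => \sum_i b i *~ A j i) =
  \sum_(f : {ffun 'I_k -> I}) wedge (b \o f) *~ \prod_j A j (f j).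
Proof.
have [f0 _|no_f] := pickP (predT : pred {ffun 'I_k -> I}).
  have := @wedge_expand_seq (enum 'I_k) f0 (fun=> 0) (enum_uniq _).
  under [RHS]eq_bigl => f.
    have -> : [forall j, (j \notin enum 'I_k) ==> (f j == f0 j)].
      by apply/forallP=> j; rewrite mem_enum.
    over.
  under [RHS]eq_bigr => f _ do rewrite big_enum.
  move=> E; transitivity (wedge (fun j =>
    if j \in enum 'I_k then \sum_i b i *~ A j i else 0)).
    by apply: eq_wedge => j; rewrite mem_enum.
  rewrite E; apply: eq_bigr => f _; congr (_ *~ _).
  by apply: eq_wedge => j; rewrite mem_enum.
(* With no function at all, [I] is empty and k is positive: every vector is an empty sum, and
   additivity in slot 0 makes the wedge zero. *)
rewrite big_pred0 //.
have /eqP := card_ffun 'I_k I; rewrite (eq_card0 no_f) card_ord eq_sym expn_eq0.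
case/andP=> /eqP I0 k_gt0; pose i0 := Ordinal k_gt0.
rewrite (@eq_wedge _ (upd (fun=> 0) i0 0)); first exact: (raddf0 (wedge_slot _ _)).
move=> j; rewrite /upd if_same big_pred0 // => i.
by have := card0_eq I0 i.
Qed.

End Expand.

(* Only the injective choices survive; those with image S differ from the     *)
(* enumeration en S by a permutation, and together they add up to a minor.    *)
Lemma wedge_minors (I : finType) (D : {set I}) (en : {set I} -> seq I)
    (b : I -> M) (A : 'I_k -> I -> int) :
    (forall S : {set I}, S \subset D -> perm_eq (en S) (enum S)) ->
  wedge (fun j => \sum_(i in D) b i *~ A j i) =
  \sum_(S : {set I} | (S \subset D) && (#|S| == k))
    wedge (seq_family k [seq b i | i <- en S]) *~
    \det (\matrix_(j, i) seq_family k [seq A j x | x <- en S] i).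
Proof.
move=> enP.
pose A' j i := if i \in D then A j i else 0.
transitivity (wedge (fun j => \sum_i b i *~ A' j i)).
  apply: eq_wedge => j; rewrite big_mkcond; apply: eq_bigr => i _ /=.
  by rewrite /A'; case: ifP => // _; rewrite mulr0z.
rewrite wedge_expand.
pose im (f : {ffun 'I_k -> I}) := [set f j | j : 'I_k].
pose P (f : {ffun 'I_k -> I}) := injectiveb f && (im f \subset D).
rewrite (bigID P) /= [X in _ + X]big1 ?addr0; last first.
  move=> f; rewrite /P negb_and.
  case/orP=> [/injectivePn[i [j ij fij]]|/subsetPn[x /imsetP[j _ ->] fjD]].
    by rewrite (@wedge_alternate _ _ _ i j) ?mul0rz //= fij.
  by rewrite (bigD1 j) //= /A' (negPf fjD) mul0r mulr0z.
rewrite (partition_big im (fun S => (S \subset D) && (#|S| == k))); last first.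
  move=> f /andP[/injectiveP finj ->] /=.
  by rewrite card_imset // card_ord.
apply: eq_bigr => S /andP[SD /eqP cS].
have sz : size (en S) == k by rewrite (perm_size (enP S SD)) -cardE cS.
pose t := Tuple sz; pose e := tnth t.
have mem_t x : (x \in en S) = (x \in S).
  by rewrite (perm_mem (enP S SD)) mem_enum.
have einj : injective e.
  by apply/tuple_uniqP; rewrite (perm_uniq (enP S SD)) enum_uniq.
have famE (N : zmodType) (h : I -> N) i :
    seq_family k [seq h x | x <- en S] i = h (e i).
  rewrite /seq_family (nth_map (tnth_default t i)) ?(eqP sz) //.
rewrite (@eq_wedge _ (b \o e)); last by move=> i; rewrite famE.
rewrite /determinant mulrz_sumr.
(* The injective choices with image [S] are exactly the composites of the enumeration [e] with a
   permutation, so their sum is the Leibniz formula. *)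
pose h (s : 'S_k) : {ffun 'I_k -> I} := [ffun j => e (s j)].
have hinj : injective h.
  move=> s1 s2 E; apply/permP=> j; apply: einj.
  by move/ffunP: E => /(_ j); rewrite !ffunE.
have -> : \sum_(f | P f && (im f == S)) wedge (b \o f) *~ \prod_j A' j (f j) =
          \sum_(f in [set h s | s in 'S_k]) wedge (b \o f) *~ \prod_j A' j (f j).
  apply: eq_bigl => f; apply/idP/imsetP.
    case/andP=> /andP[/injectiveP finj _] /eqP fS.
    have /fin_all_exists[g gE] : forall j, exists i, e i = f j.
      move=> j; have : f j \in en S by rewrite mem_t -fS imset_f.
      by case/(tnthP t) => i ->; exists i.
    have ginj : injective g.
      by move=> i j E; apply: finj; rewrite -!gE E.
    exists (perm ginj); first by rewrite inE.
    by apply/ffunP=> j; rewrite ffunE permE gE.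
  case=> s _ ->{f}.
  have hS : im (h s) = S.
    apply/eqP; rewrite eqEcard; apply/andP; split.
      by apply/subsetP=> _ /imsetP[j _ ->]; rewrite ffunE -mem_t (mem_tnth _ t).
    rewrite cS card_imset ?card_ord // => i j; rewrite !ffunE.
    by move/einj/perm_inj.
  rewrite /P hS SD eqxx !andbT; apply/injectiveP => i j; rewrite !ffunE.
  by move/einj/perm_inj.
rewrite big_imset /=; last by move=> ? ? _ _; apply: hinj.
apply: eq_big => [s|s _]; first by rewrite inE.
rewrite (@eq_wedge _ ((b \o e) \o s)); last by move=> j; rewrite /= ffunE.
rewrite wedge_perm -mulrzA; congr (_ *~ (_ * _)).
apply: eq_bigr => j _; rewrite mxE famE ffunE /A'.
by rewrite (subsetP SD) // -mem_t (mem_tnth _ t).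
Qed.

End WedgeExpansion.

(** * Coordinates, boundary and flow conservation *)

Section Coordinates.
Variable G : graph.
Implicit Types (e f : edge G) (v : vertex G) (c : C1 G) (S T : {set edge G}).

(** The signed form is odd in [f], hence lifts to C_1(G); between positive edges it is the Kronecker
    symbol. *)
Definition edge_delta e f : int := (e == f)%:R - (einv e == f)%:R.

Lemma einv_eq e f : (einv e == f) = (e == einv f).
Proof. by rewrite (can2_eq (@einvK G) (@einvK G)). Qed.

Lemma edge_delta_einvr e f : edge_delta e (einv f) = - edge_delta e f.
Proof. by rewrite /edge_delta opprB -!einv_eq einvK. Qed.

Lemma edge_delta_einvl e f : edge_delta (einv e) f = - edge_delta e f.
Proof. by rewrite /edge_delta opprB einvK. Qed.

Definition edge_coord e c : int := chain_lift (edge_delta e) c.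

HB.instance Definition _ e := GRing.isZmodMorphism.Build _ _ (edge_coord e)
  (chain_lift_is_zmod_morphism (edge_delta_einvr e)).

Lemma edge_coordB e : {morph edge_coord e : a b / a - b}.
Proof. exact: raddfB. Qed.

Lemma edge_coord_chain e f : edge_coord e (edge_chain f) = edge_delta e f.
Proof. exact/chain_lift_edge/edge_delta_einvr. Qed.

Lemma chain_ind (P : C1 G -> Prop) :
  P 0 -> (forall a b, P a -> P b -> P (a - b)) ->
  (forall e, P (edge_chain e)) -> forall c, P c.
Proof. exact: presented_ind. Qed.

Lemma edge_coord_einv e c : edge_coord (einv e) c = - edge_coord e c.
Proof.
elim/chain_ind: c => [|a b IHa IHb|f]; first by rewrite !raddf0.
  by rewrite !edge_coordB IHa IHb opprB opprK addrC.
by rewrite !edge_coord_chain edge_delta_einvl.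
Qed.

Let endpoints e : C0 G := << tgt e >> - << src e >>.

Let endpoints_einv e : endpoints (einv e) = - endpoints e.
Proof. by rewrite /endpoints src_einv tgt_einv opprB. Qed.

Let boundaryE c : boundary c = chain_lift endpoints c.
Proof.
rewrite /boundary /chain_lift [RHS](bigID (fun e => e \in dom (prepr c))) /=.
rewrite [X in _ + X]big1 ?addr0 => [|e /coeff_outdom ->]; last by rewrite mulr0z.
rewrite -[RHS]big_filter; apply/perm_big/uniq_perm; first exact: uniq_dom.
  by rewrite filter_uniq ?index_enum_uniq.
by move=> e; rewrite mem_filter mem_index_enum andbT.
Qed.

Lemma boundary_is_zmod_morphism : zmod_morphism (@boundary G).
Proof.
by move=> a b; rewrite !boundaryE chain_lift_is_zmod_morphism.
Qed.
HB.instance Definition _ := GRing.isZmodMorphism.Build _ _ (@boundary G)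
  boundary_is_zmod_morphism.

(** The sum runs over both orientations: an edge leaving [v] is counted through its inverse, whose
    coordinate has the opposite sign. *)
Lemma coeff_boundary v c :
  coeff v (boundary c) = \sum_(e | tgt e == v) edge_coord e c.
Proof.
elim/chain_ind: c => [|a b IHa IHb|f].
- by rewrite !raddf0 big1 // => e _; rewrite raddf0.
- by rewrite raddfB coeffB IHa IHb -sumrB; apply: eq_bigr => e _; rewrite edge_coordB.
rewrite boundary_edge_chain coeffB !coeffU !mul1r.
under eq_bigr => e _ do rewrite edge_coord_chain.
rewrite sumrB; have E g : \sum_(e | tgt e == v) (e == g)%:R = (tgt g == v)%:R :> int.
  rewrite big_mkcond (bigD1 g) //= eqxx big1 ?addr0; first by case: ifP.
  by move=> e /negPf->; rewrite if_same.
rewrite E; under eq_bigr => e _ do rewrite einv_eq.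
by rewrite E tgt_einv.
Qed.

Lemma cycles_sum c v : cycles c -> \sum_(e | tgt e == v) edge_coord e c = 0.
Proof. by rewrite -coeff_boundary => ->; rewrite coeff0. Qed.

Lemma cyclesB a b : @cycles G a -> cycles b -> cycles (a - b).
Proof. by rewrite /cycles raddfB /= => -> ->; rewrite subr0. Qed.

Section Oriented.
Variable o : orientation G.

Lemma edge_delta_positive e f :
  e \in positive o -> f \in positive o -> edge_delta e f = (e == f)%:R.
Proof.
move=> pe pf; rewrite /edge_delta.
suff /negPf-> : einv e != f by rewrite subr0.
by apply: contraTneq pf => <-; rewrite positive_einv pe.
Qed.

Lemma positiveVneg e : (e \in positive o) || (einv e \in positive o).
Proof. by rewrite positive_einv orbN. Qed.

Lemma chain_expansion c : c = \sum_(e in positive o) edge_chain e *~ edge_coord e c.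
Proof.
elim/chain_ind: c => [|a b {1}-> {1}->|f].
- by rewrite big1 // => e _; rewrite raddf0.
- by rewrite -sumrB; apply: eq_bigr => e _; rewrite edge_coordB mulrzBr.
wlog pf : f / f \in positive o => [H|].
  case/orP: (positiveVneg f) => pf; first exact: H.
  rewrite -[f]einvK edge_chain_einv {1}(H _ pf) -sumrN.
  by apply: eq_bigr => e _; rewrite raddfN mulrNz.
rewrite (bigD1 f) //= edge_coord_chain edge_delta_positive // eqxx mulr1z.
rewrite big1 ?addr0 // => e /andP[pe /negPf ne].
by rewrite edge_coord_chain edge_delta_positive // ne mulr0z.
Qed.

Lemma chain_eq0 c : (forall e, e \in positive o -> edge_coord e c = 0) -> c = 0.
Proof.
by move=> c0; rewrite [c]chain_expansion big1 // => e /c0->; rewrite mulr0z.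
Qed.

(** Stability under inversion kills the coordinates outside [S] of each generator. Conversely, only
    edges of [S] survive in the expansion of [c] over the positive edges. *)
Lemma chains_onP S c : is_subgraph S ->
  chains_on S c <-> (forall e, e \notin S -> edge_coord e c = 0).
Proof.
move=> sS; split=> [|c0].
  elim=> [e _|x y _ IHx _ IHy e eS|_ [f fS ->] e eS]; first by rewrite raddf0.
    by rewrite edge_coordB IHx ?IHy.
  have ne g : g \in S -> g != e by apply: contraTneq => ->.
  rewrite edge_coord_chain /edge_delta einv_eq ![e == _]eq_sym.
  by rewrite !(negPf (ne _ _)) ?subr0 //; move/forall_inP: sS => /(_ _ fS).
rewrite [c]chain_expansion.
have sg0 : chains_on S 0.
  exact: subgroup_gen0.
elim/big_ind: _ => // [x y cx cy|e _].
  rewrite -[y]opprK -[- y]sub0r; apply: (subgroup_genB cx).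
  exact: subgroup_genB.
have [eS|/c0->] := boolP (e \in S); last by rewrite mulr0z.
have ce : chains_on S (edge_chain e).
  by apply: subgroup_gen_in; exists e.
elim/int_ind: (edge_coord e c) => [|n IH|n IH]; first by rewrite mulr0z.
  rewrite intS addrC mulrzDr mulr1z -[edge_chain e as X in _ + X]opprK.
  by apply: (subgroup_genB IH); rewrite -sub0r; apply: subgroup_genB.
by rewrite intS addrC opprD mulrzBr mulr1z; apply: subgroup_genB.
Qed.

End Oriented.

(** * Paths, cycles and acyclicity *)

Lemma path_chain T x y : connect (adjacent T) x y ->
  exists2 c, chains_on T c & boundary c = << y >> - << x >>.
Proof.
case/connectP=> p; elim: p x => [|z p IH] x /=.
  by move=> _ ->; exists 0; [exact: subgroup_gen0|rewrite raddf0 subrr].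
case/andP=> /exists_inP[e eT /andP[/eqP sx /eqP tz]] pz /(IH _ pz)[c cT bc].
exists (c - (0 - edge_chain e)).
  apply: (subgroup_genB cT); apply: subgroup_genB; first exact: subgroup_gen0.
  by apply: subgroup_gen_in; exists e.
by rewrite sub0r opprK raddfD /= bc boundary_edge_chain sx tz subrKA.
Qed.

(* Follow edges carrying positive flow: conservation at each vertex lets the  *)
(* walk go on, and it must eventually close up.                               *)
Lemma acyclic_cycle_eq0 (o : orientation G) T c :
  is_subgraph T -> is_acyclic T -> cycles c -> chains_on T c -> c = 0.
Proof.
move=> sT aT cc /(chains_onP o c sT) cT.
apply: (chain_eq0 (o := o)) => e1 _; apply: contra_notP aT => /eqP ce1.
have [e0 ce0] : exists e, 0 < edge_coord e c.
  case: (ltrgt0P (edge_coord e1 c)) ce1 => // [c0 _|c0 _]; first by exists e1.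
  by exists (einv e1); rewrite edge_coord_einv oppr_gt0.
pose pos e := 0 < edge_coord e c.
have posT e : pos e -> e \in T.
  by rewrite /pos; apply: contraTT => /cT ->; rewrite ltxx.
pose good v := [exists e, pos e && (src e == v)].
(* The default [e0] is only reached at vertices that are not [good]. *)
pose out v := odflt e0 [pick e | pos e && (src e == v)].
have outP v : good v -> pos (out v) /\ src (out v) = v.
  rewrite /out => /existsP[e he]; case: pickP => [f /andP[pf /eqP]//|/(_ e)].
  by rewrite he.
pose h v := tgt (out v).
have goodtgt e : pos e -> good (tgt e).
  (* If no positive flow left [tgt e], all terms of the conservation law there would be nonnegative,
     and that of [e] positive. *)
  move=> pe; apply: contraPT (cycles_sum (tgt e) cc) => ng; apply/eqP.
  rewrite gt_eqF // (bigD1 e) //= ltr_wpDr // sumr_ge0 // => f /andP[/eqP tf _].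
  rewrite leNgt; apply: contra ng => cf; apply/existsP; exists (einv f).
  by rewrite /pos edge_coord_einv oppr_gt0 cf src_einv tf /=.
have goodh v : good v -> good (h v) by case/outP=> /goodtgt.
pose v0 := tgt e0; have gv0 : good v0 by exact: goodtgt.
have goodi n : good (iter n h v0) by elim: n => //= n /goodh.
(* The orbit of [v0] returns to its [i]-th point [w] after [n] steps, so the last [n - i] points
   form the closed walk. *)
have /trajectP[i i_lt Ei] := looping_order h v0.
set n := fingraph.order h v0 in i_lt Ei.
pose w := iter i h v0; pose m := (n - i)%N.
have m_gt0 : (0 < m)%N by rewrite subn_gt0.
have wm : iter m h w = w by rewrite /w -iterD subnK // ltnW.
have uw : uniq (traject h w m).
  have := orbit_uniq h v0; rewrite /fingraph.orbit -/n -[n](subnKC (ltnW i_lt)).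
  by rewrite trajectD cat_uniq => /and3P[].
have goodw v : v \in traject h w m -> good v.
  by case/trajectP => j _ ->; rewrite /w -iterD.
exists [seq out v | v <- traject h w m].
have srcE : [seq src e | e <- [seq out v | v <- traject h w m]] = traject h w m.
  rewrite -map_comp -[RHS]map_id; apply/eq_in_map => v /goodw /outP[_ sv].
  exact: sv.
apply/and5P; split.
- by rewrite -size_eq0 size_map size_traject -lt0n.
- by apply/allP => _ /mapP[v /goodw /outP[/posT ? _] ->].
- case: m m_gt0 wm uw goodw srcE => // m _ wm uw goodw _ /=.
  rewrite -map_rcons path_map.
  have -> : rcons (traject h (h w) m) w = traject h (h w) m.+1.
    by rewrite trajectSr -iterSr wm.
  have : {in traject h (h w) m.+1, forall v, good v}.
    by rewrite trajectSr -iterSr wm => v; rewrite mem_rcons => /goodw.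
  elim: m.+1 {wm uw goodw} w => //= l IH u gu.
  have [_ ->] := outP _ (gu _ (mem_head _ _)).
  rewrite eqxx; apply: IH => v vl; apply: gu; exact: mem_behead.
- by rewrite srcE.
(* An edge and its inverse cannot both carry positive flow. *)
apply/allP => _ /mapP[v /goodw /outP[pv _] ->]; apply/mapP => -[u /goodw].
case/outP=> pu _ E; move: pu; rewrite -E /pos edge_coord_einv oppr_gt0.
by apply/negP; rewrite -leNgt ltW.
Qed.

(** The chain is the sum of the edges of [p]. Its boundary telescopes, and since no inverse of an
    edge of [p] lies in [p], nothing cancels the first edge. *)
Lemma simple_cycle_chain T p : simple_cycle T p ->
  exists c, [/\ cycles c, chains_on T c & c <> 0].
Proof.
case/and5P; case: p => // e p _ pT cp _ np.
exists (\sum_(f <- e :: p) edge_chain f); split.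
- rewrite /cycles raddf_sum.
  under eq_bigr => f _ do rewrite /= boundary_edge_chain.
  have E : forall (x : edge G) s, path (fun e f => tgt e == src f) x s ->
      \sum_(f <- s) (<< tgt f >> - << src f >>) =
      << tgt (last x s) >> - << tgt x >> :> C0 G.
    move=> x s; elim: s x => [|y s IH] x; first by rewrite big_nil subrr.
    case/andP=> /eqP xy /IH {}IH; rewrite big_cons IH xy addrC.
    by rewrite subrKA.
  have perm_rot : perm_eq (e :: p) (rcons p e) by rewrite perm_sym perm_rcons.
  by rewrite (perm_big _ perm_rot) /= (E _ _ cp) last_rcons subrr.
- move: (e :: p) pT => s; elim: s => [_|f s IH /andP[fT /IH cs]].
    by rewrite big_nil; exact: subgroup_gen0.
  rewrite big_cons addrC -[edge_chain f]opprK -[- edge_chain f]sub0r.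
  apply: (subgroup_genB cs); apply: subgroup_genB; first exact: subgroup_gen0.
  by apply: subgroup_gen_in; exists f.
move/(congr1 (edge_coord e)); rewrite raddf0 raddf_sum /=; apply/eqP.
have E f : f \in e :: p -> edge_coord e (edge_chain f) = (e == f)%:R.
  rewrite edge_coord_chain /edge_delta => fp.
  case: (einv e =P f) => [E|_]; last by rewrite subr0.
  by move/allP: np => /(_ e (mem_head _ _)); rewrite E fp.
by rewrite (eq_big_seq _ E) big_cons eqxx gt_eqF // ltr_pwDl // sumr_ge0.
Qed.

End Coordinates.

(** * Orthogonality of cycles and cuts *)

Section Cuts.
Variables (G : graph) (o : orientation G).

Lemma edge_coord_sum (I : Type) (r : seq I) (P : pred I) e (F : I -> C1 G) a :
  edge_coord e (\sum_(i <- r | P i) F i *~ a i) =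
  \sum_(i <- r | P i) edge_coord e (F i) * a i.
Proof.
by rewrite raddf_sum; apply: eq_bigr => i _; rewrite raddfMz mulrzz.
Qed.

(** Flow conservation summed over the vertices of [C]; edges with both ends in [C] cancel out. *)
Lemma cut_sum (C : {set vertex G}) (c : C1 G) : cycles c ->
  \sum_(e in positive o) ((tgt e \in C)%:R - (src e \in C)%:R) * edge_coord e c = 0.
Proof.
move=> cc.
have flow v :
    \sum_(e in positive o) ((tgt e == v)%:R - (src e == v)%:R) * edge_coord e c = 0.
  transitivity (coeff v (boundary c)); last by rewrite cc coeff0.
  rewrite [c in RHS](chain_expansion o) (raddf_sum (@boundary G)) (raddf_sum (coeff v)).
  apply: eq_bigr => e _.
  by rewrite !raddfMz /= mulrzz boundary_edge_chain coeffB !coeffU !mul1r.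
have memE x : (x \in C)%:R = \sum_(v in C) (x == v)%:R :> int.
  rewrite big_mkcond (bigD1 x) //= eqxx big1 ?addr0; first by case: ifP.
  by move=> v; rewrite eq_sym => /negPf->; rewrite if_same.
under eq_bigr => e _ do rewrite !memE -sumrB mulr_suml.
by rewrite exchange_big big1.
Qed.

End Cuts.

(** * The basis attached to a spanning tree *)

Section SpanningTree.
Variables (G : graph) (o : orientation G) (K T : {set edge G}).
Hypotheses (sK : is_subgraph K) (treeT : T \in spanning_trees G).
Hypothesis TK : T \subset K.

Let sT : is_subgraph T. Proof. by move: treeT; rewrite inE => /and3P[]. Qed.

Let aT : is_acyclic T.
Proof. by move: treeT; rewrite inE => /and3P[_ _ /asboolP]. Qed.

Let z e := tree_proj T (edge_chain e).

Lemma tree_projP e :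
  cycles (tree_proj T (edge_chain e)) /\
  chains_on T (edge_chain e - tree_proj T (edge_chain e)).
Proof.
have ex : exists x, cycles x /\ chains_on T (edge_chain e - x).
  have /andP[_ /forallP/(_ (src e))/forallP/(_ (tgt e))] : is_connected T.
    by move: treeT; rewrite inE => /and3P[].
  case/path_chain=> c cT bc; exists (edge_chain e - c); split.
    by rewrite /cycles raddfB /= bc boundary_edge_chain subrr.
  by rewrite opprB addrC subrK.
exact: (classical_sets.xgetPex 0 ex).
Qed.

Lemma edge_coord_tree_proj e f : f \notin T ->
  edge_coord f (tree_proj T (edge_chain e)) = edge_delta f e.
Proof.
move=> fT; have [_ /(chains_onP o _ sT)/(_ _ fT)] := tree_projP e.
by rewrite edge_coordB edge_coord_chain => /eqP; rewrite subr_eq0 => /eqP->.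
Qed.

Lemma positive_edgesP S :
  perm_eq (positive_edges o S) (enum (S :&: positive o)).
Proof. by rewrite perm_sort. Qed.

Lemma mem_positive_edges S e :
  (e \in positive_edges o S) = (e \in S) && (e \in positive o).
Proof. by rewrite (perm_mem (positive_edgesP S)) mem_enum inE. Qed.

Lemma positive_edges_uniq S : uniq (positive_edges o S).
Proof. by rewrite (perm_uniq (positive_edgesP S)) enum_uniq. Qed.

Let p := positive_edges o (K :\: T).

Lemma cycles_on_tree_proj e : e \in p -> cycles_on K (z e).
Proof.
rewrite mem_positive_edges inE -andbA => /and3P[_ eK _].
split; first by case: (tree_projP e).
apply/(chains_onP o _ sK) => f fK.
rewrite edge_coord_tree_proj; last by apply: contraNN fK; apply: (subsetP TK).
rewrite /edge_delta einv_eq.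
have ne g : g \in K -> f == g = false by move=> gK; apply: contraNF fK => /eqP->.
by rewrite !ne ?subr0 //; move/forall_inP: sK => /(_ _ eK).
Qed.

Lemma edge_coord_tree_basis e f : f \in p -> e \in p -> edge_coord f (z e) = (f == e)%:R.
Proof.
rewrite !mem_positive_edges inE -andbA => /and3P[fT _ pf] /andP[_ pe].
by rewrite edge_coord_tree_proj // (edge_delta_positive pf pe).
Qed.

(* The difference of the two sides is a cycle supported in the tree T. *)
Lemma tree_basis_expansion c : cycles_on K c ->
  c = \sum_(e <- p) z e *~ edge_coord e c.
Proof.
case=> cc cK; apply/eqP; rewrite -subr_eq0; apply/eqP.
apply: (acyclic_cycle_eq0 o sT aT).
  apply: cyclesB => //; rewrite /cycles raddf_sum big1 // => e _.
  by rewrite raddfMz /=; have [-> _] := tree_projP e; rewrite mul0rz.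
apply/(chains_onP o _ sT) => f.
wlog pf : f / f \in positive o => [H fT|fT].
  have [|pf] := boolP (f \in positive o); first by move/H; apply.
  apply/eqP; rewrite -oppr_eq0 -edge_coord_einv; apply/eqP/H.
    by rewrite positive_einv.
  apply: contra fT => fT; rewrite -[f]einvK.
  by move/forall_inP: sT => /(_ _ fT).
rewrite edge_coordB edge_coord_sum; have [fK|fK] := boolP (f \in K).
  have fp : f \in p by rewrite mem_positive_edges inE fT fK.
  rewrite (big_rem f) //= edge_coord_tree_basis // eqxx mul1r big_seq big1.
    by rewrite addr0 subrr.
  move=> e; rewrite mem_rem_uniq ?positive_edges_uniq // inE => /andP[ne ep].
  by rewrite edge_coord_tree_basis // eq_sym (negPf ne) mul0r.
rewrite ((chains_onP o _ sK).1 cK) // big_seq big1 ?subr0 // => e ep.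
have [_ zK] := cycles_on_tree_proj ep.
by rewrite ((chains_onP o _ sK).1 zK) // mul0r.
Qed.

Section Basis.
Variables (k : nat) (ZK : 'I_k -> C1 G).
Hypothesis hZK : is_zbasis (cycles_on K) ZK.

(** [A] holds the coordinates of [ZK] along [p], and [B] expresses the fundamental cycles in [ZK].
    They are mutually inverse, which forces equal sizes. *)
Lemma size_tree_basis : size p = k.
Proof.
pose t := in_tuple p.
have tp i : tnth t i \in p by apply: mem_tnth.
have /fin_all_exists[b bE] : forall l, exists a : {ffun 'I_k -> int},
    z (tnth t l) = \sum_j ZK j *~ a j.
  move=> l; have [a []] := hZK.2 _ (cycles_on_tree_proj (tp l)).
  by exists a.
pose A := \matrix_(l < size p, j < k) edge_coord (tnth t l) (ZK j).
pose B := \matrix_(j < k, l < size p) b l j.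
have AB : A *m B = 1%:M.
  apply/matrixP=> i l; rewrite !mxE.
  under eq_bigr => j _ do rewrite !mxE.
  rewrite -edge_coord_sum -bE edge_coord_tree_basis //; congr (nat_of_bool _)%:R.
  by apply/eqP/eqP => [|->//]; apply/tuple_uniqP/positive_edges_uniq.
(* Expanding [ZK l] in fundamental cycles and these back in [ZK] must return the coordinates of
   [ZK l] in its own basis, by uniqueness. *)
have BA : B *m A = 1%:M.
  apply/matrixP=> j l.
  have [a [_ uniq_a]] := hZK.2 _ (hZK.1 l).
  have <- : a j = (B *m A) j l.
    rewrite (uniq_a [ffun j => (B *m A) j l]) ?ffunE //.
    rewrite [LHS](tree_basis_expansion (hZK.1 l)) -[p]/(val t) big_tuple.
    under eq_bigr => i _ do rewrite bE mulrz_suml.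
    rewrite exchange_big; apply: eq_bigr => i _; rewrite ffunE mxE mulrz_sumr.
    by apply: eq_bigr => m _; rewrite !mxE mulrzA.
  rewrite (uniq_a [ffun j => (j == l)%:R]) ?ffunE ?mxE //.
  rewrite (bigD1 l) //= ffunE eqxx mulr1z big1 ?addr0 // => i /negPf ne.
  by rewrite ffunE ne mulr0z.
by apply/eqP; rewrite eqn_leq (mulmx1_min AB) (mulmx1_min BA).
Qed.

(** [tree_basis_expansion] provides one matrix; by duality, taking the coordinate along [tnth t i]
    determines row [i] of whichever matrix [xget] selects. *)
Lemma basis_matrix_tree (t : k.-tuple (edge G)) : val t = p ->
  basis_matrix ZK (tree_basis o K T k) =
  \matrix_(i, j) edge_coord (tnth t i) (ZK j).
Proof.
move=> tp; have tip i : tnth t i \in p by rewrite -tp mem_tnth.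
have tbE i : tree_basis o K T k i = z (tnth t i).
  rewrite /tree_basis /seq_family (nth_map (tnth_default t i)).
    by rewrite (tnth_nth (tnth_default t i)) tp.
  by rewrite -/p -tp size_tuple.
set A0 := (RHS).
have ex : exists A : 'M[int]_k,
    forall j, ZK j = \sum_i tree_basis o K T k i *~ A i j.
  exists A0 => j; rewrite {1}[ZK j](tree_basis_expansion (hZK.1 j)) -tp big_tuple.
  by apply: eq_bigr => i _; rewrite tbE mxE.
have bmE := classical_sets.xgetPex 0 ex.
apply/matrixP=> i j; rewrite mxE {1}bmE edge_coord_sum.
rewrite (bigD1 i) //= tbE edge_coord_tree_basis // eqxx mul1r.
rewrite big1 ?addr0 // => l li; rewrite tbE edge_coord_tree_basis //.
suff /negPf-> : tnth t i != tnth t l by rewrite mul0r.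
apply: contraNneq li => E; rewrite eq_sym; apply/eqP; move: i l E.
by apply/tuple_uniqP; rewrite tp positive_edges_uniq.
Qed.

End Basis.
End SpanningTree.

(* If K minus these edges contains a cycle, its coordinates in ZK form a      *)
(* left kernel vector; if it is disconnected, a cut forms a right one.        *)
Lemma det_coord_eq0 (G : graph) (o : orientation G) (K : {set edge G}) (k : nat)
    (ZK : 'I_k -> C1 G) (t : k.-tuple (edge G)) :
    is_subgraph K -> is_connected K -> is_zbasis (cycles_on K) ZK ->
    uniq t -> {subset t <= K :&: positive o} ->
    K :\: [set e | (e \in t) || (einv e \in t)] \notin spanning_trees G ->
  \det (\matrix_(j, i) edge_coord (tnth t i) (ZK j)) = 0.
Proof.
move=> sK cK hZK ut tK; set T := _ :\: _.
have sT : is_subgraph T.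
  apply/forall_inP=> e; rewrite !inE einvK orbC => /andP[-> eK].
  by move/forall_inP: sK; apply.
have tT i : tnth t i \notin T by rewrite !inE mem_tnth.
rewrite inE sT /= negb_and => /orP[cT|/asboolPn aT]; last first.
  have {aT}[p /simple_cycle_chain[c [cc cT c0]]] : exists p, simple_cycle T p.
    exact: contrapT.
  have cK' : cycles_on K c.
    split=> //; apply/(chains_onP o _ sK) => e eK.
    apply: ((chains_onP o _ sT).1 cT); apply: contraNN eK.
    by rewrite inE => /andP[].
  have [a [cE _]] := hZK.2 _ cK'.
  apply/eqP/det0P; exists (\row_j a j).
    apply: contra_notN c0 => /eqP/rowP a0; rewrite cE big1 // => j _.
    by have := a0 j; rewrite !mxE => ->; rewrite mulr0z.
  apply/rowP=> i; rewrite !mxE.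
  under eq_bigr => j _ do rewrite !mxE mulrC.
  by rewrite -edge_coord_sum -cE ((chains_onP o _ sT).1 cT).
move: cK cT; rewrite /is_connected => /andP[-> cK] /=.
case/forallPn=> x /forallPn[y nxy].
pose C := [set v | connect (adjacent T) x v].
(* The coboundary of the indicator of [C], the component of [x] in [T]: it vanishes on [T] and pairs
   to zero with cycles. *)
pose d e : int := (tgt e \in C)%:R - (src e \in C)%:R.
have d_einv e : d (einv e) = - d e by rewrite /d src_einv tgt_einv opprB.
have dT e : e \in T -> d e = 0.
  move=> eT; have ad f : f \in T -> connect (adjacent T) (src f) (tgt f).
    by move=> fT; apply/connect1/exists_inP; exists f; rewrite ?eqxx.
  apply/eqP; rewrite subr_eq0 !inE; apply/eqP; congr (nat_of_bool _)%:R.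
  apply/idP/idP => h; apply: (connect_trans h); last exact: ad.
  rewrite -tgt_einv -[tgt e]src_einv; apply: ad.
  by move/forall_inP: sT; apply.
rewrite -det_tr; apply/eqP/det0P; exists (\row_i d (tnth t i)).
  (* Were [d] zero on [t] as well, no edge of [K] would leave [C], and connectedness of [K] would
     put [y] in [C]. *)
  apply: contraNneq nxy => /rowP d0.
  have dt e : e \in t -> d e = 0.
    by case/tnthP=> i ->; have := d0 i; rewrite !mxE.
  have dK e : e \in K -> d e = 0.
    have [/dT//|] := boolP (e \in T).
    rewrite !inE => + eK; rewrite eK andbT negbK => /orP[/dt//|/dt/eqP].
    by rewrite d_einv oppr_eq0 => /eqP.
  have Cclosed : closed (adjacent K) (mem C).
    move=> u v /exists_inP[e /dK/eqP] + /andP[/eqP <- /eqP <-].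
    by rewrite subr_eq0 /=; do 2!case: (_ \in C).
  move: cK => /forallP/(_ x)/forallP/(_ y)/(closed_connect Cclosed).
  by rewrite /= !inE connect0 => <-.
apply/rowP=> j; rewrite !mxE.
under eq_bigr => i _ do rewrite !mxE.
have [cj cjK] := hZK.1 j.
rewrite -[RHS](cut_sum o C cj).
rewrite -(big_tuple _ _ t xpredT (fun e => d e * edge_coord e (ZK j))).
(* A positive edge outside [t] lies either in [T], where [d] vanishes, or outside [K], where the
   cycle has coordinate 0. *)
rewrite big_uniq //= [RHS](bigID (mem t)) /= [X in _ + X]big1 ?addr0.
  apply: eq_bigl => e /=; case et : (e \in t); last by rewrite andbF.
  by move/tK: et; rewrite inE => /andP[_ ->].
move=> e /andP[pe et]; have [eK|eK] := boolP (e \in K).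
  rewrite -/(d e) dT ?mul0r // !inE (negPf et) eK andbT /=.
  apply/negP => /tK; rewrite inE => /andP[_].
  by rewrite positive_einv pe.
by rewrite ((chains_onP o _ sK).1 cjK) // mulr0.
Qed.

(** * From minors to spanning trees *)

Theorem proposition3p1 (G : graph) (o : orientation G)
    (hG : is_connected [set: edge G])
    (k : nat) (K : {set edge G}) (hK : K \in connected_subgraphs G k)
    (ZK : 'I_k -> C1 G) (hZK : is_zbasis (cycles_on K) ZK) :
  wedge ZK =
    \sum_(T in spanning_trees G | T \subset K)
      edge_wedge o k (K :\: T) *~ basis_det ZK (tree_basis o K T k).
Proof.
have [sK cK] : is_subgraph K /\ is_connected K.
  by move: hK; rewrite inE => /and3P[].
pose D := K :&: positive o.
have DI (S : {set edge G}) : S \subset D -> S :&: positive o = S.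
  by move=> SD; apply/setIidPl/(subset_trans SD)/subsetIr.
have enP (S : {set edge G}) : S \subset D -> perm_eq (positive_edges o S) (enum S).
  by move=> SD; rewrite -{2}(DI S SD) positive_edgesP.
have ZKE j : ZK j = \sum_(e in D) edge_chain e *~ edge_coord e (ZK j).
  rewrite [LHS](chain_expansion o) (bigID (mem K)) /= [X in _ + X]big1 ?addr0.
    by apply: eq_bigl => e; rewrite inE andbC.
  move=> e /andP[_ eK]; have [_ cj] := hZK.1 j.
  by rewrite ((chains_onP o _ sK).1 cj) // mulr0z.
rewrite (eq_wedge ZKE) (wedge_minors _ _ enP).
pose tree (S : {set edge G}) := K :\: [set e | (e \in S) || (einv e \in S)].
have treeS (S : {set edge G}) : S \subset D -> (K :\: tree S) :&: positive o = S.
  move=> SD; apply/setP=> e; rewrite !inE.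
  case eS : (e \in S); first by have := subsetP SD _ eS; rewrite inE => /andP[-> ->].
  rewrite /=; case eK : (e \in K); rewrite ?andbF //= !andbT negbK.
  apply/negP => /andP[/(subsetP SD)]; rewrite inE positive_einv => /andP[_].
  by move/negP.
have peE (S : {set edge G}) : S \subset D ->
    positive_edges o (K :\: tree S) = positive_edges o S.
  by move=> SD; rewrite /positive_edges treeS // DI.
have famE (S : {set edge G}) (tS : k.-tuple (edge G)) : val tS = positive_edges o S ->
    forall i j, seq_family k [seq edge_coord x (ZK j) | x <- positive_edges o S] i =
                edge_coord (tnth tS i) (ZK j).
  move=> tSE i j; rewrite /seq_family (nth_map (tnth_default tS i)).
    by rewrite -tSE -tnth_nth.
  by rewrite -tSE size_tuple.
have tup (S : {set edge G}) : S \subset D -> #|S| = k ->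
    size (positive_edges o S) == k.
  by move=> SD cS; rewrite (perm_size (enP S SD)) -cardE cS.
rewrite (bigID (fun S => tree S \in spanning_trees G)) /=.
rewrite [X in _ + X]big1 ?addr0; last first.
  move=> S /andP[/andP[SD /eqP cS] nT].
  have tE : val (Tuple (tup S SD cS)) = positive_edges o S by [].
  set w := wedge _; rewrite -[RHS](mulr0z w); congr (_ *~ _).
  rewrite -(@det_coord_eq0 G o K k ZK (Tuple (tup S SD cS))) //.
  - by congr (\det _); apply/matrixP=> j i; rewrite !mxE (famE _ _ tE).
  - exact: positive_edges_uniq.
  - move=> e; rewrite mem_positive_edges => /andP[eS _].
    by apply: (subsetP SD).
  rewrite (_ : _ :\: _ = tree S) //; apply/setP=> e; rewrite !inE.
  by rewrite !(perm_mem (enP S SD)) !mem_enum.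
(* Trees in [K] correspond to their complementary sets of positive edges; stability of [K] and [T]
   under inversion recovers [T] from this set. *)
rewrite [RHS](reindex_onto tree (fun T => (K :\: T) :&: positive o)); last first.
  move=> T /andP[]; rewrite inE => /and3P[/forall_inP sT _ _] /subsetP TK.
  apply/setP=> e; rewrite !inE.
  have eT : (einv e \in T) = (e \in T).
    by apply/idP/idP => /sT; rewrite ?einvK.
  have eK : (einv e \in K) = (e \in K).
    by move/forall_inP: sK => sK'; apply/idP/idP => /sK'; rewrite ?einvK.
  rewrite eT eK positive_einv -andb_orr orbN andbT.
  by case: (boolP (e \in T)) => [/TK->|_] //=; case: (e \in K).
have TK (S : {set edge G}) : tree S \subset K by rewrite subsetDl.
apply: eq_big => S.
  rewrite TK andbT; apply/idP/idP => [/andP[/andP[SD _] ->]|].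
    by rewrite treeS ?eqxx.
  case/andP=> tT /eqP SE.
  have SD : S \subset D by rewrite -SE /D setSI // subsetDl.
  (* The tree side does not mention the size of [S]; it is the rank of Z_1(K). *)
  rewrite SD tT andbT /=; apply/eqP.
  have := size_tree_basis o sK tT (TK S) hZK.
  by rewrite peE // (perm_size (enP S SD)) -cardE.
case/andP=> /andP[SD /eqP cS] tT; rewrite /edge_wedge peE //; congr (_ *~ _).
pose t := Tuple (tup S SD cS).
have tE : val t = positive_edges o S by [].
rewrite /basis_det (basis_matrix_tree (t := t) sK tT (TK S) hZK) ?peE //.
(* The vectors of [ZK] index the rows of the minors but the columns of [basis_matrix]. *)
rewrite -det_tr; congr (\det _); apply/matrixP=> i j.
by rewrite !mxE (famE _ _ tE).
Qed.
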